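(* Let $A, B$ be $n\times n$ positive definite complex matrices. If $A\preceq B$ (near order), then $A\le_{\lambda} B$ (eigenvalue entrywise order).
   Context: Positive definite means Hermitian positive definite. For positive definite $A,B$, the metric geometric mean is $A\sharp B = A^{1/2}(A^{-1/2}BA^{-1/2})^{1/2}A^{1/2}$. The near order $A\preceq B$ means $A^{-1}\sharp B\ge I$, where $\ge$ is the Löwner order ($X\ge Y$ iff $X-Y$ is positive semidefinite). For positive definite $A$, $\lambda_1(A)\ge\cdots\ge\lambda_n(A)$ denote its eigenvalues in nonincreasing order; $A\le_\lambda B$ means $\lambda_i(A)\le\lambda_i(B)$ for all $1\le i\le n$. *)

(* Defs.v *)
From mathcomp Require Import all_boot all_order all_algebra.

Set Implicit Arguments.
Unset Strict Implicit.
Unset Printing Implicit Defensive.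

Import Order.TTheory GRing.Theory Num.Theory.
Local Open Scope ring_scope.
Local Open Scope sesquilinear_scope.

(* In a numClosedFieldType, [0 <= z] and [0 < z] entail that z is real; more
   generally [x <= y] means that y - x is a nonnegative real. *)

Section Defs.
Variables (C : numClosedFieldType) (n : nat).
Implicit Types A B : 'M[C]_n.

Definition posdefmx A :=
  A \is hermsymmx /\
  forall v : 'cV[C]_n, v != 0 -> 0 < (v ^t* *m A *m v) 0 0.

Definition possemidefmx A :=
  A \is hermsymmx /\ forall v : 'cV[C]_n, 0 <= (v ^t* *m A *m v) 0 0.

Definition loewner_le A B := possemidefmx (B - A).

(* Spectral calculus: [spectralmx A] is a unitary matrix P such that
   A = P^-1 diag(spectral_diag A) P whenever A is normal. *)
Definition mxsqrt A : 'M[C]_n :=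
  invmx (spectralmx A) *m diag_mx (map_mx sqrtC (spectral_diag A))
    *m spectralmx A.

Definition mxgeomean A B : 'M[C]_n :=
  let S := mxsqrt A in
  let T := invmx S in
  S *m mxsqrt (T *m B *m T) *m S.

Definition near_le A B := loewner_le 1%:M (mxgeomean (invmx A) B).

(* The n roots of the characteristic polynomial, with multiplicity, in
   nonincreasing order. Sorting is meaningful as soon as they are all real. *)
Definition eigenvals A : seq C :=
  sort (fun x y => y <= x) (sval (closed_field_poly_normal (char_poly A))).

(* Both sides are real when A and B are Hermitian. *)
Definition eigen_le A B :=
  forall i : 'I_n, (eigenvals A)`_i <= (eigenvals B)`_i.

End Defs.

Section Facts.
Variables (C : numClosedFieldType) (n : nat).
Implicit Types A B : 'M[C]_n.

Lemma hermsymE A : (A \is hermsymmx) = (A == A ^t* ).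
Proof. by rewrite is_hermitianmxE expr0 scale1r. Qed.

Lemma trmxC_mul m p q (A : 'M[C]_(m, p)) (B : 'M[C]_(p, q)) :
  (A *m B) ^t* = B ^t* *m A ^t*.
Proof. by rewrite trmx_mul map_mxM. Qed.

Lemma posdefmx_spectralE A : posdefmx A ->
  A = (spectralmx A) ^t* *m diag_mx (spectral_diag A) *m spectralmx A.
Proof.
case=> hA _; have /orthomx_spectralP := hermitian_normalmx hA.
by rewrite invmx_unitary ?spectral_unitarymx.
Qed.

Lemma posdefmx_spectral_diag_gt0 A i : posdefmx A -> 0 < spectral_diag A 0 i.
Proof.
move=> pA; pose e : 'cV[C]_n := delta_mx i 0.
have [_ /(_ ((spectralmx A) ^t* *m e))] := pA.
have uP := unitarymxP (spectral_unitarymx A).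
have -> : ((spectralmx A) ^t* *m e) ^t* *m A *m ((spectralmx A) ^t* *m e) =
    e ^t* *m diag_mx (spectral_diag A) *m e.
  rewrite trmxC_mul trmxCK.
  transitivity (e ^t* *m spectralmx A *m
    ((spectralmx A) ^t* *m diag_mx (spectral_diag A) *m spectralmx A) *m
    ((spectralmx A) ^t* *m e)); first by rewrite -posdefmx_spectralE.
  by rewrite -!mulmxA !(mulmxA (spectralmx A) ((spectralmx A) ^t* )) uP !mul1mx.
have -> : e ^t* = delta_mx 0 i.
  by rewrite trmx_delta map_delta_mx.
have -> : ((delta_mx 0 i : 'rV_n) *m diag_mx (spectral_diag A) *m e) 0 0
    = spectral_diag A 0 i.
  by rewrite -rowE -colE !mxE eqxx mulr1n.
apply.
apply/eqP => /(congr1 (mulmx (spectralmx A))).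
rewrite mulmxA uP mul1mx mulmx0 => /matrixP/(_ i 0).
by rewrite !mxE !eqxx => /eqP; rewrite oner_eq0.
Qed.

Lemma mxsqrt_posdef A : posdefmx A -> posdefmx (mxsqrt A).
Proof.
move=> pA; rewrite /mxsqrt invmx_unitary ?spectral_unitarymx //.
set P := spectralmx A; set d := map_mx sqrtC _.
have d_gt0 i : 0 < d 0 i.
  by rewrite mxE sqrtC_gt0 posdefmx_spectral_diag_gt0.
split.
  rewrite hermsymE !trmxC_mul trmxCK mulmxA tr_diag_mx map_diag_mx.
  apply/eqP; congr (_ *m diag_mx _ *m _); apply/rowP=> i.
  by rewrite [RHS]mxE; symmetry; apply: geC0_conj; rewrite ltW.
move=> v v0; have uP : P \in unitmx := spectral_unit A.
have -> : v ^t* *m (P ^t* *m diag_mx d *m P) *m v =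
          (P *m v) ^t* *m diag_mx d *m (P *m v).
  by rewrite trmxC_mul !mulmxA.
have : P *m v != 0.
  by apply: contraNneq v0 => Pv0; rewrite -(mulKmx uP v) Pv0 mulmx0.
move: (P *m v) => w w0.
rewrite -mulmxA mxE.
have [i wi] : exists i, w i 0 != 0.
  apply/existsP; apply: contraNT w0; rewrite negb_exists => /forallP w0.
  apply/eqP/matrixP => i j; rewrite ord1 mxE; apply/eqP.
  by have := w0 i; rewrite negbK.
have E j : (w ^t* 0 j * (diag_mx d *m w) j 0) = d 0 j * `|w j 0| ^+ 2.
  by rewrite mul_diag_mx !mxE normCKC; rewrite mulrCA.
rewrite (eq_bigr _ (fun j _ => E j)) (bigD1 i) //= ltr_wpDr //.
  by apply: sumr_ge0 => j _; rewrite mulr_ge0 ?exprn_ge0 // ltW.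
by rewrite mulr_gt0 // exprn_gt0 // normr_gt0.
Qed.

Lemma mxsqrtK A : posdefmx A -> mxsqrt A *m mxsqrt A = A.
Proof.
move=> pA; have uP := spectral_unit A.
rewrite [RHS](posdefmx_spectralE pA) /mxsqrt -invmx_unitary
  ?spectral_unitarymx //.
rewrite !mulmxA mulmxK // -[X in X *m _]mulmxA mulmx_diag.
congr (_ *m diag_mx _ *m _); apply/rowP=> i.
by rewrite !mxE -expr2 sqrtCK.
Qed.

Lemma mxsqrt_unique A B : posdefmx A -> posdefmx B -> B *m B = A ->
  B = mxsqrt A.
Proof.
move=> pA pB BA; have pS := mxsqrt_posdef pA; have SA := mxsqrtK pA.
move: (mxsqrt A) pS SA => S pS SA; pose X := S - B.
have hX : X \is hermsymmx.
  case: pS pB => /[!hermsymE] /eqP hS _ [/[!hermsymE] /eqP hB _].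
  by rewrite linearB /= map_mxB -hS -hB.
have XE : S *m X + X *m B = 0.
  by rewrite mulmxBr mulmxBl SA BA addrA subrK subrr.
have XD := orthomx_spectralP (hermitian_normalmx hX).
suff dX : spectral_diag X = 0.
  by move: XD; rewrite dX linear0 mulmx0 mul0mx => /subr0_eq ->.
have uP := spectral_unit X.
apply/rowP => i; rewrite [RHS]mxE; set m := spectral_diag X 0 i.
pose v : 'cV_n := invmx (spectralmx X) *m delta_mx i 0.
have v0 : v != 0.
  apply/eqP => /(congr1 (mulmx (spectralmx X))).
  rewrite mulmx0 mulKVmx // => /matrixP/(_ i 0).
  by rewrite !mxE !eqxx => /eqP; rewrite oner_eq0.
have Xv : X *m v = m *: v.
  rewrite XD /v mulmxA mulmxK // -mulmxA scalemxAr; congr (_ *m _).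
  by apply/matrixP=> j k; rewrite mul_diag_mx !mxE; case: eqP => [->|_] //=;
    rewrite ?mulr0.
clearbody v.
have mR : m^* = m.
  exact: CrealP (mxOverP (hermitian_spectral_diag_real hX) 0 i).
have vX : v ^t* *m X = m *: v ^t*.
  move: hX; rewrite hermsymE => /eqP ->; rewrite -trmxC_mul Xv.
  by rewrite linearZ /= map_mxZ /= mR.
have := congr1 (fun Y => (v ^t* *m Y *m v) 0 0) XE.
rewrite /= mulmxDr mulmxDl mulmx0 mul0mx.
rewrite -!mulmxA Xv -!scalemxAr !mulmxA vX -!scalemxAl.
rewrite [LHS]mxE [in LHS]mxE [X in _ + X]mxE [RHS]mxE -mulrDr => /eqP.
rewrite mulf_eq0 => /orP[/eqP //|].
have [_ /(_ v v0) Sv] := pS; have [_ /(_ v v0) Bv] := pB.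
by rewrite gt_eqF // addr_gt0.
Qed.

Lemma eigenvals_char_poly A :
  char_poly A = \prod_(z <- eigenvals A) ('X - z%:P).
Proof.
rewrite (perm_big _ (permEl (perm_sort _ _))) /=.
case: closed_field_poly_normal => s /= E.
by rewrite {1}E (monicP (char_poly_monic A)) scale1r.
Qed.

Lemma size_eigenvals A : size (eigenvals A) = n.
Proof.
have := size_char_poly A.
by rewrite eigenvals_char_poly size_prod_XsubC => -[].
Qed.

End Facts.

(* Main.v *)
Require Import Defs.
From mathcomp Require Import all_boot all_order all_algebra.
From mathcomp Require Import reals complex.

Set Implicit Arguments.
Unset Strict Implicit.
Unset Printing Implicit Defensive.

Import Order.TTheory GRing.Theory Num.Theory.
Local Open Scope ring_scope.
Local Open Scope sesquilinear_scope.

(** Put [G = A^-1 # B]. It solves the Riccati equation [G A G = B] ([mxgeomean_riccati]), and the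
    near order says [G >= I], whence [G^2 >= I] ([loewner_1_sqr]). Congruence by [S = A^(1/2)] gives
    [A <= S G^2 S], and [S G^2 S = (S G)(G S)] is similar to [(G S)(S G) = B]. It remains to see
    that the Löwner order implies the eigenvalue order (Weyl monotonicity, [loewner_eigen_le]); this
    follows by counting, for every real [t], the eigenvalues that are at least [t]
    ([loewner_card_spectral_ge]). *)

(** * Kernels and similarity *)

Lemma wide_mx_ker (F : fieldType) (p q : nat) (M : 'M[F]_(p, q)) :
  (p < q)%N -> exists2 x : 'cV[F]_q, x != 0 & M *m x = 0.
Proof.
move=> lt_pq; have : kermx M^T != 0.
  rewrite kermx_eq0 -row_leq_rank -ltnNge mxrank_tr.
  exact: leq_ltn_trans (rank_leq_row _) lt_pq.
case/rowV0Pn => u /sub_kermxP uM u0; exists u^T.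
  by rewrite -(inj_eq (@trmx_inj _ _ _)) trmxK trmx0.
by apply: trmx_inj; rewrite trmx_mul trmxK uM trmx0.
Qed.

Lemma char_poly_conj (F : fieldType) (n : nat) (P A : 'M[F]_n) :
  P \in unitmx -> char_poly (invmx P *m A *m P) = char_poly A.
Proof.
move=> uP; rewrite /char_poly /char_poly_mx !map_mxM /=.
have PK : map_mx polyC (invmx P) *m map_mx polyC P = 1%:M.
  by rewrite -map_mxM mulVmx // map_mx1.
have -> : 'X%:M - map_mx polyC (invmx P) *m map_mx polyC A *m map_mx polyC P =
    map_mx polyC (invmx P) *m ('X%:M - map_mx polyC A) *m map_mx polyC P.
  rewrite mulmxBr mulmxBl scalar_mxC.
  by rewrite -[_ *m _ *m map_mx polyC P in RHS]mulmxA PK mulmx1.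
by rewrite !det_mulmx mulrAC -det_mulmx PK det1 mul1r.
Qed.

Section Hermitian.
Variables (C : numClosedFieldType) (n : nat).
Implicit Types (A B U : 'M[C]_n) (v : 'cV[C]_n).

(** The two products are similar: [A B = B^-1 (B A) B]. *)
Lemma char_poly_mulmxC A B :
  B \in unitmx -> char_poly (A *m B) = char_poly (B *m A).
Proof.
by move=> uB; rewrite -(char_poly_conj (B *m A) uB) mulKmx.
Qed.

(** * Quadratic forms in eigenbases *)

Lemma hermsymmx_conj A B : A \is hermsymmx -> B ^t* *m A *m B \is hermsymmx.
Proof.
by rewrite !hermsymE !trmxC_mul trmxCK mulmxA => /eqP<-.
Qed.

(** Unitary maps preserve the norm. The sum over coordinates of [U v] is meant for a termwise
    comparison with [dotmx_spectral]. *)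
Lemma dotmx_unitary U v : U \is unitarymx ->
  (v ^t* *m v) 0 0 = \sum_i `|(U *m v) i 0| ^+ 2.
Proof.
move=> uU; have UK : U ^t* *m U = 1%:M.
  by rewrite -invmx_unitary // mulVmx // unitarymx_unit.
have -> : v ^t* *m v = (U *m v) ^t* *m (U *m v).
  by rewrite trmxC_mul mulmxA -(mulmxA _ _ U) UK mulmx1.
by rewrite mxE; apply: eq_bigr => i _; rewrite !mxE normCKC.
Qed.

Lemma dotmx_spectral A v : A \is hermsymmx ->
  (v ^t* *m A *m v) 0 0 =
  \sum_i spectral_diag A 0 i * `|(spectralmx A *m v) i 0| ^+ 2.
Proof.
move=> hA; have -> : v ^t* *m A *m v =
    (spectralmx A *m v) ^t* *m (diag_mx (spectral_diag A) *m (spectralmx A *m v)).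
  have /orthomx_spectralP := hermitian_normalmx hA.
  rewrite invmx_unitary ?spectral_unitarymx // => {1}->.
  by rewrite trmxC_mul !mulmxA.
move: (_ *m v) => w; rewrite mxE; apply: eq_bigr => i _.
by rewrite mul_diag_mx !mxE normCKC mulrCA.
Qed.

(* If A had more eigenvalues >= t than B, some nonzero v would lie in the span
   of the corresponding eigenvectors of A and be orthogonal to those of B, so
   that v^* A v >= t |v|^2 > v^* B v. *)
Lemma loewner_card_spectral_ge A B (t : C) :
  A \is hermsymmx -> B \is hermsymmx -> loewner_le A B -> t \is Num.real ->
  (#|[pred i | (t <= spectral_diag A 0 i)%R]|
     <= #|[pred i | (t <= spectral_diag B 0 i)%R]|)%N.
Proof.
move=> hA hB [_ AB] tR.
set I := [pred i | _]; set J := [pred i | _ <= spectral_diag B _ _].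
rewrite leqNgt; apply/negP => ltJI.
pose E : 'M[C]_(n, #|I|) := colsub (@enum_val _ I) 1%:M.
pose P := spectralmx A; pose Q := spectralmx B.
have uP : P \is unitarymx := spectral_unitarymx A.
have uQ : Q \is unitarymx := spectral_unitarymx B.
(* [E] extends a vector indexed by [I] by zero. The matrix here sends [x] to the coordinates in [J]
   of [Q v], and it has fewer rows than columns. *)
have [x x0 xE] := wide_mx_ker (rowsub (@enum_val _ J) (Q *m P ^t* *m E)) ltJI.
pose v := P ^t* *m (E *m x).
have Pv : P *m v = E *m x by rewrite mulmxA (unitarymxP uP) mul1mx.
have Ex i : i \notin I -> (E *m x) i 0 = 0.
  move=> iI; rewrite mxE big1 // => k _; rewrite !mxE.
  case: eqP => [ik|_]; last by rewrite mul0r.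
  by rewrite ik enum_valP in iI.
have Qv j : j \in J -> (Q *m v) j 0 = 0.
  move=> jJ; have /matrixP/(_ (enum_rank_in jJ j) 0) := xE.
  rewrite -mul_rowsub_mx -mulmxA -mul_rowsub_mx -!mulmxA !mul_rowsub_mx.
  by rewrite !mxE enum_rankK_in // => <-.
have v0 : v != 0.
  apply: contraNneq x0 => v0; apply/eqP/colP => k; rewrite mxE.
  have /colP/(_ (enum_val k)) := Pv; rewrite v0 mulmx0 !mxE => ->.
  rewrite (bigD1 k) //= !mxE eqxx mul1r big1 ?addr0 // => l lk.
  by rewrite !mxE (inj_eq enum_val_inj) eq_sym (negPf lk) mul0r.
have geA : t * (v ^t* *m v) 0 0 <= (v ^t* *m A *m v) 0 0.
  rewrite (dotmx_spectral _ hA) (dotmx_unitary _ uP) mulr_sumr.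
  apply: ler_sum => i _; have [iI|iI] := boolP (i \in I).
    by rewrite ler_wpM2r // exprn_ge0.
  by rewrite -/P Pv Ex // normr0 expr0n !mulr0.
have ltB : (v ^t* *m B *m v) 0 0 < t * (v ^t* *m v) 0 0.
  rewrite (dotmx_spectral _ hB) (dotmx_unitary _ uQ) mulr_sumr.
  have dlt i : i \notin J -> spectral_diag B 0 i < t.
    rewrite inE -real_ltNge //.
    exact: (mxOverP (hermitian_spectral_diag_real hB)).
  have Qv0 : Q *m v != 0.
    apply: contraNneq v0 => Q0.
    by rewrite -(mulKmx (unitarymx_unit uQ) v) Q0 mulmx0.
  (* A nonzero coordinate of [Q v] has its index outside [J], which makes one term strictly
     smaller. *)
  have [j Qj] : exists j, (Q *m v) j 0 != 0.
    apply/existsP; apply: contraNT Qv0; rewrite negb_exists => /forallP w0.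
    by apply/eqP/colP => j; rewrite [RHS]mxE; apply/eqP; rewrite -[_ == _]negbK.
  rewrite (bigD1 j) //= [X in _ < X](bigD1 j) //=; apply: ltr_leD.
    rewrite ltr_pM2r ?exprn_gt0 ?normr_gt0 //.
    by apply: dlt; apply: contraNN Qj => /Qv->.
  apply: ler_sum => i _; have [iJ|iJ] := boolP (i \in J).
    by rewrite -/Q Qv // normr0 expr0n !mulr0.
  by rewrite ler_wpM2r ?exprn_ge0 // ltW // dlt.
have := AB v; rewrite mulmxBr mulmxBl [X in 0 <= X]mxE [X in _ + X]mxE subr_ge0.
by move=> /(le_trans geA)/le_lt_trans/(_ ltB); rewrite ltxx.
Qed.

(** * Sorted eigenvalues and Weyl monotonicity *)

(** By the spectral theorem both lists split the same characteristic polynomial into monic linear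
    factors, and such a splitting is unique up to order. *)
Lemma perm_eigenvals_spectral A : A \is hermsymmx ->
  perm_eq (eigenvals A) (codom (spectral_diag A 0)).
Proof.
move=> hA; apply: prod_XsubC_eq; rewrite -eigenvals_char_poly.
have /orthomx_spectralP {1}-> := hermitian_normalmx hA.
rewrite char_poly_conj ?spectral_unit // char_poly_trig ?diag_mx_is_trig //.
by rewrite big_image; apply: eq_bigr => i _; rewrite !mxE eqxx.
Qed.

Lemma eigenvals_real A : A \is hermsymmx -> all (mem Num.real) (eigenvals A).
Proof.
move=> hA; rewrite (perm_all _ (perm_eigenvals_spectral hA)).
apply/allP => _ /codomP[i ->].
exact: (mxOverP (hermitian_spectral_diag_real hA)).
Qed.

(** The order on [C] is only partial, so sorting is justified by the eigenvalues being real, hence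
    comparable. *)
Lemma eigenvals_sorted A : A \is hermsymmx ->
  sorted (fun x y => y <= x) (eigenvals A).
Proof.
move=> hA; apply: (@sort_sorted_in _ (mem Num.real)).
  by move=> x y xR yR; rewrite orbC; apply: real_leVge.
by have := eigenvals_real hA; rewrite (perm_all _ (permEl (perm_sort _ _))).
Qed.

Lemma count_eigenvals A (a : pred C) : A \is hermsymmx ->
  count a (eigenvals A) = #|[pred i | a (spectral_diag A 0 i)]|.
Proof.
move=> hA; have /permP-> := perm_eigenvals_spectral hA.
by rewrite count_map cardE -size_filter !enumT; congr size; apply: eq_filter.
Qed.

(** Take for threshold [t] the entry of index [i] (from 0) for [A]. At least [i + 1] eigenvalues of
    [A] reach [t], hence so do at least [i + 1] of [B]; were the entry of [B] below [t], at most [i]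
    would. *)
Lemma loewner_eigen_le A B : A \is hermsymmx -> B \is hermsymmx ->
  loewner_le A B -> eigen_le A B.
Proof.
move=> hA hB AB i; set t := (eigenvals A)`_i.
have ge_tr : transitive (fun x y : C => y <= x).
  by move=> y x z yx zy; apply: le_trans zy yx.
have ge_rf : reflexive (fun x y : C => y <= x) by move=> x; apply: lexx.
have tR : t \is Num.real.
  by apply: (allP (eigenvals_real hA)); rewrite mem_nth ?size_eigenvals.
have := loewner_card_spectral_ge hA hB AB tR.
rewrite -!count_eigenvals // => le_count.
have cA : (i < count (fun x => t <= x)%R (eigenvals A))%N.
  rewrite -(cat_take_drop i.+1 (eigenvals A)) count_cat.
  (* The list is nonincreasing, so its entries of index 0 to [i] are all at least [t]. *)
  have /eqP-> : count (fun x => t <= x)%R (take i.+1 (eigenvals A)) == i.+1.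
    rewrite -[X in _ == X](@size_takel i.+1 _ (eigenvals A)) ?size_eigenvals //.
    rewrite -all_count; apply/(all_nthP 0) => k.
    rewrite size_takel ?size_eigenvals // => ki; rewrite nth_take //.
    apply: (sorted_leq_nth ge_tr ge_rf 0 (eigenvals_sorted hA)) => //.
    - by rewrite inE size_eigenvals (leq_ltn_trans _ (ltn_ord i)).
    - by rewrite inE size_eigenvals.
  exact: leq_addr.
have tlt := leq_trans cA le_count.
have bR : (eigenvals B)`_i \is Num.real.
  by apply: (allP (eigenvals_real hB)); rewrite mem_nth ?size_eigenvals.
rewrite real_leNgt //; apply/negP => ltBA.
move: tlt; rewrite ltnNge => /negP; apply.
rewrite -(cat_take_drop i (eigenvals B)) count_cat.
(* From index [i] on, the entries for [B] are at most the one at [i], hence below [t]. *)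
have /eqP-> : count (fun x => t <= x)%R (drop i (eigenvals B)) == 0%N.
  rewrite -leqn0 leqNgt -has_count; apply/(has_nthP 0) => -[k].
  rewrite size_drop size_eigenvals nth_drop => ki.
  apply/negP; rewrite lt_geF //; apply: le_lt_trans ltBA.
  apply: (sorted_leq_nth ge_tr ge_rf 0 (eigenvals_sorted hB)) => //.
  - by rewrite inE size_eigenvals.
  - by rewrite inE size_eigenvals -ltn_subRL.
  - exact: leq_addr.
rewrite addn0 (leq_trans (count_size _ _)) //.
by rewrite size_takel // size_eigenvals ltnW.
Qed.

(** * Positive matrices, inverses and congruence *)

Lemma posdefmx_unit A : posdefmx A -> A \in unitmx.
Proof.
(* [det0P] yields row vectors, so the transpose is used to get a column killed by [A], on which the
   form vanishes. *)
move=> [_ pA]; rewrite unitmxE unitfE -det_tr; apply/det0P => -[u u0 uA].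
have ut0 : u^T != 0 by rewrite -(inj_eq (@trmx_inj _ _ _)) trmxK trmx0.
have := pA _ ut0; rewrite -mulmxA.
have -> : A *m u^T = 0 by apply: trmx_inj; rewrite trmx_mul trmxK uA trmx0.
by rewrite mulmx0 mxE ltxx.
Qed.

Lemma posdefmx_conj A B : B \in unitmx -> posdefmx A ->
  posdefmx (B ^t* *m A *m B).
Proof.
move=> uB [hA pA]; split; first exact: hermsymmx_conj.
move=> v v0; have -> : v ^t* *m (B ^t* *m A *m B) *m v =
    (B *m v) ^t* *m A *m (B *m v) by rewrite trmxC_mul !mulmxA.
by apply: pA; apply: contraNneq v0 => Bv; rewrite -(mulKmx uB v) Bv mulmx0.
Qed.

Lemma possemidefmx_conj A B : possemidefmx A -> possemidefmx (B ^t* *m A *m B).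
Proof.
move=> [hA pA]; split; first exact: hermsymmx_conj.
move=> v; have -> : v ^t* *m (B ^t* *m A *m B) *m v =
    (B *m v) ^t* *m A *m (B *m v) by rewrite trmxC_mul !mulmxA.
exact: pA.
Qed.

Lemma hermsymmx_inv A : A \is hermsymmx -> invmx A \is hermsymmx.
Proof.
by rewrite !hermsymE trmx_inv map_invmx => /eqP<-.
Qed.

Lemma posdefmx_inv A : posdefmx A -> posdefmx (invmx A).
Proof.
move=> pA; have uA := posdefmx_unit pA.
have /hermsymmx_inv := pA.1; rewrite hermsymE => /eqP hA.
have := posdefmx_conj (B := invmx A); rewrite unitmx_inv => /(_ A uA pA).
by rewrite -hA mulVmx // mul1mx.
Qed.

(** * Geometric mean and near order *)

(** With [A = S^2] the mean is [S Q S], where [Q^2 = S^-1 B S^-1]. The inner factors cancel against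
    [A^-1 = S^-1 S^-1], leaving [S Q^2 S = B]. *)
Lemma mxgeomean_riccati A B : posdefmx A -> posdefmx B ->
  mxgeomean A B *m invmx A *m mxgeomean A B = B.
Proof.
move=> pA pB; rewrite /mxgeomean.
have := mxsqrt_posdef pA; have := mxsqrtK pA; move: (mxsqrt A) => S SA pS.
have uS := posdefmx_unit pS; have pT := posdefmx_inv pS.
have /mxsqrtK : posdefmx (invmx S *m B *m invmx S).
  (* The left factor [S^-1] is replaced by its adjoint to exhibit a congruence. *)
  have := pT.1; rewrite hermsymE => /eqP {1}->.
  by apply: posdefmx_conj; rewrite ?unitmx_inv.
move: (mxsqrt _) => Q QQ.
have -> : invmx A = invmx S *m invmx S.
  rewrite -SA; apply: (can_inj (mulKmx uS)); rewrite mulKVmx //.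
  apply: (can_inj (mulKmx uS)); rewrite mulmxV // mulmxA mulmxV //.
  by rewrite unitmx_mul uS.
rewrite !mulmxA mulmxK // mulmxKV // -(mulmxA S Q Q) QQ.
by rewrite !mulmxA mulmxV // mul1mx mulmxKV.
Qed.

(** With [A = X + I] and [X >= 0], [A^2 - I = X^2 + 2 X], where [X^2 = X^* X >= 0]. *)
Lemma loewner_1_sqr A : loewner_le 1%:M A -> loewner_le 1%:M (A *m A).
Proof.
rewrite /loewner_le; move: (A - 1%:M) (subrK 1%:M A) => X <- [hX pX].
have -> : (X + 1%:M) *m (X + 1%:M) - 1%:M = X *m X + (X + X).
  by rewrite mulmxDl !mulmxDr !mul1mx !mulmx1 -!addrA subrr addr0.
move: (hX); rewrite hermsymE => /eqP XE.
split.
  by rewrite hermsymE !linearD /= !map_mxD trmxC_mul -XE.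
move=> v; rewrite !mulmxDr !mulmxDl [X in 0 <= X]mxE [X in _ + X]mxE.
rewrite !addr_ge0 //.
have -> : v ^t* *m (X *m X) *m v = (X *m v) ^t* *m (X *m v).
  by rewrite trmxC_mul -XE !mulmxA.
rewrite mxE; apply: sumr_ge0 => i _.
by rewrite !mxE mulrC mul_conjC_ge0.
Qed.

(* G := A^-1 # B satisfies G A G = B and G^2 >= I, so with S := A^(1/2) we get
   A <= S G^2 S = (S G) (G S), which has the eigenvalues of (G S) (S G) = B. *)
Lemma near_le_eigen_le A B :
  posdefmx A -> posdefmx B -> near_le A B -> eigen_le A B.
Proof.
move=> pA pB; rewrite /near_le => G1.
have := mxgeomean_riccati (posdefmx_inv pA) pB; rewrite invmxK.
move: (mxgeomean _ _) G1 => G G1 GAG.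
have uG : G \in unitmx.
  by have := posdefmx_unit pB; rewrite -GAG unitmx_mul => /andP[].
have hG : G = G ^t*.
  have /[!hermsymE]/eqP := G1.1; rewrite linearB /= map_mxB trmx1 map_mx1.
  exact: (can_inj (subrK _)).
have SA := mxsqrtK pA; have pS := mxsqrt_posdef pA; move: (mxsqrt A) SA pS.
move=> S SA pS; have uS := posdefmx_unit pS.
have := pS.1; rewrite hermsymE => /eqP hS.
have AM : loewner_le A (S *m (G *m G) *m S).
  have := possemidefmx_conj S (loewner_1_sqr G1).
  by rewrite -hS mulmxBr mulmxBl mulmx1 SA.
have hM : S *m (G *m G) *m S \is hermsymmx.
  by rewrite {1}hS hermsymmx_conj // hermsymE trmxC_mul -hG.
have eM : char_poly (S *m (G *m G) *m S) = char_poly B.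
  rewrite -GAG -SA !mulmxA -[_ *m G *m S]mulmxA char_poly_mulmxC ?mulmxA //.
  by rewrite unitmx_mul uG.
have := loewner_eigen_le pA.1 hM AM.
(* [eigenvals] is computed from [char_poly] alone, so equal polynomials give the same list. *)
by rewrite /eigen_le /eigenvals eM.
Qed.

End Hermitian.

Theorem theorem2p4 (R : realType) (n : nat) (A B : 'M[complex R]_n)
    (hA : posdefmx A) (hB : posdefmx B) (hAB : near_le A B) :
  eigen_le A B.
Proof. exact: near_le_eigen_le. Qed.
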